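(* Let $m\ge1$ be an integer. For $k\ge0$ let $f_{-m+k}$ (resp. $g_{-m+k}$) be the generating function, with respect to the size (marked by $z$), of grand zigzag knight's paths staying above the line $y=-m$ and ending at altitude $-m+k$ with an up-step $N$ or $E$ (resp. with a down-step $\bar N$ or $\bar E$), the empty path being counted in $f_0$. Put $F(u)=\sum_{k\ge0}f_{-m+k}u^k$ and $G(u)=\sum_{k\ge0}g_{-m+k}u^k$, and let $$r=\frac{1-z^4-z^2-\sqrt{z^8-2z^6-z^4-2z^2+1}}{2z^3},\qquad s=\frac{1-z^4-z^2+\sqrt{z^8-2z^6-z^4-2z^2+1}}{2z^3}.$$ Then $$F(u)=-\frac{u\left(u^m(1+z^2u+zu^2)-r^{m-1}z(u+z)(z+rz^2+r^2)\right)}{z^3(u-r)(u-s)},$$ $$G(u)=\frac{r^{m-1}(z+r^2+z^2r)-zu^{m-1}(1+zu)(1+z^2u+zu^2)}{z^3(u-r)(u-s)}.$$ Setting $H(u):=F(u)+G(u)$, the generating function for the total number of grand zigzag knight's paths staying above $y=-m$ with respect to the size is $$H(1)=\frac{zr^{m-1}+z^2r^m+r^{m+1}-z^2-z-1}{z^2+z-1}.$$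
   Context: A grand zigzag knight's path is a lattice path in $\mathbb{Z}^2$ starting at the origin, made of steps $N=(1,2)$, $\bar N=(1,-2)$, $E=(2,1)$, $\bar E=(2,-1)$, such that the vertical components of two consecutive steps never have the same direction (up-steps $N,E$ and down-steps $\bar N,\bar E$ alternate); the empty path is allowed. The size is the $x$-coordinate and the altitude the $y$-coordinate of the last point. A path stays above the line $y=-m$ if all its points have $y$-coordinate $\ge -m$ (points on the line are allowed). The square root is the power series branch with value $1$ at $z=0$, so $r$ is a power series in $z$ with leading term $z^3$ and $s=1/r$. *)

(* Defs.v *)
From HB Require Import structures.
From mathcomp Require Import all_boot all_order all_algebra.
From mathcomp Require Import boolp.

Set Implicit Arguments.
Unset Strict Implicit.
Unset Printing Implicit Defensive.

Import Order.TTheory GRing.Theory Num.Theory.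

Local Open Scope ring_scope.

(** * Formal power series in one variable *)

(* A record rather than a plain alias of [nat -> R], so that the pointwise ring
   structure on functions is not picked up by unification. *)
Record fps (R : comNzRingType) := Fps { fps_coef :> nat -> R }.

Notation "{ 'fps' R }" := (fps R) (format "{ 'fps'  R }") : type_scope.

Section FpsRing.
Variable R : comNzRingType.
Implicit Types a b c : {fps R}.

Lemma fpsP a b : a =1 b -> a = b.
Proof. by case: a b => [a] [b] /= ab; congr Fps; apply/funext. Qed.

HB.instance Definition _ := gen_eqMixin {fps R}.
HB.instance Definition _ := gen_choiceMixin {fps R}.

Definition fps_add a b := Fps (fun n => a n + b n).
Definition fps_opp a := Fps (fun n => - a n).
Definition fpsC (x : R) := Fps (fun n => if n == 0%N then x else 0).
Definition fpsX := Fps (fun n => (n == 1%N)%:R : R).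
Definition fps_mul a b := Fps (fun n => \sum_(i < n.+1) a i * b (n - i)%N).

Lemma fps_addA : associative fps_add.
Proof. by move=> a b c; apply: fpsP => n /=; rewrite addrA. Qed.
Lemma fps_addC : commutative fps_add.
Proof. by move=> a b; apply: fpsP => n /=; rewrite addrC. Qed.
Lemma fps_add0 : left_id (fpsC 0) fps_add.
Proof. by move=> a; apply: fpsP => n /=; case: eqP; rewrite add0r. Qed.
Lemma fps_addN : left_inverse (fpsC 0) fps_opp fps_add.
Proof. by move=> a; apply: fpsP => n /=; case: eqP; rewrite addNr. Qed.

HB.instance Definition _ :=
  GRing.isZmodule.Build {fps R} fps_addA fps_addC fps_add0 fps_addN.

Definition fps_trunc N a : {poly R} := \poly_(i < N) a i.

Lemma fps_mul_trunc N a b n :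
  (n < N)%N -> fps_mul a b n = (fps_trunc N a * fps_trunc N b)`_n.
Proof.
move=> nN; rewrite coefM /=; apply: eq_bigr => i _; rewrite !coef_poly.
have iN : (i < N)%N by apply: leq_trans nN; apply: ltn_ord.
by rewrite iN (leq_ltn_trans (leq_subr _ _) nN).
Qed.

Lemma fps_mulC : commutative fps_mul.
Proof.
by move=> a b; apply: fpsP => n; rewrite !(@fps_mul_trunc n.+1) // mulrC.
Qed.

Lemma fps_mulA : associative fps_mul.
Proof.
move=> a b c; apply: fpsP => n; set N := n.+1.
have tr3 a' b' c' : (fps_mul (fps_mul a' b') c') n =
    (fps_trunc N a' * fps_trunc N b' * fps_trunc N c')`_n.
  rewrite (@fps_mul_trunc N) // !(coefM _ (fps_trunc N c')).
  apply: eq_bigr => i _; congr (_ * _).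
  by rewrite coef_poly ltn_ord (@fps_mul_trunc N) ?ltn_ord.
by rewrite [in LHS]fps_mulC !tr3 [in LHS]mulrC mulrA.
Qed.

Lemma fps_mul1 : left_id (fpsC 1) fps_mul.
Proof.
move=> a; apply: fpsP => n /=.
rewrite big_ord_recl /= mul1r subn0 big1 ?addr0 // => i _.
by rewrite mul0r.
Qed.

Lemma fps_mulDl : left_distributive fps_mul fps_add.
Proof.
move=> a b c; apply: fpsP => n /=; rewrite -big_split /=.
by apply: eq_bigr => i _; rewrite mulrDl.
Qed.

Lemma fps_1neq0 : fpsC 1 != 0.
Proof.
apply/eqP => /(congr1 (fun a : {fps R} => a 0%N)) /= /eqP.
by rewrite oner_eq0.
Qed.

HB.instance Definition _ := GRing.Zmodule_isComNzRing.Build {fps R}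
  fps_mulA fps_mulC fps_mul1 fps_mulDl fps_1neq0.

Lemma coef_fps0 n : (0 : {fps R}) n = 0.
Proof. by rewrite /0 /=; case: eqP. Qed.
Lemma coef_fps1 n : (1 : {fps R}) n = (n == 0%N)%:R.
Proof. by rewrite /1 /=; case: eqP. Qed.
Lemma coef_fpsD a b n : (a + b) n = a n + b n. Proof. by []. Qed.
Lemma coef_fpsN a n : (- a) n = - a n. Proof. by []. Qed.
Lemma coef_fpsM a b n : (a * b) n = \sum_(i < n.+1) a i * b (n - i)%N.
Proof. by []. Qed.

Definition fps_unit a := `[< exists b, b * a = 1 >].
Definition fps_inv a :=
  if pselect (exists b, b * a = 1) is left h then projT1 (cid h) else a.

Lemma fps_mulVr : {in fps_unit, left_inverse 1 fps_inv *%R}.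
Proof.
move=> a /asboolP ha; rewrite /fps_inv; case: pselect => // h.
by case: (cid h).
Qed.
Lemma fps_unitP a b : b * a = 1 -> fps_unit a.
Proof. by move=> h; apply/asboolP; exists b. Qed.
Lemma fps_inv_out : {in [predC fps_unit], fps_inv =1 id}.
Proof.
move=> a; rewrite inE /= => /asboolP h; rewrite /fps_inv.
by case: pselect.
Qed.

HB.instance Definition _ := GRing.ComNzRing_hasMulInverse.Build {fps R}
  fps_mulVr fps_unitP fps_inv_out.

End FpsRing.

Arguments fpsX {R}.

Section FpsIdomain.
Variable R : idomainType.
Implicit Types a b : {fps R}.

Lemma fps_valuation a : a != 0 ->
  exists n, a n != 0 /\ forall i, (i < n)%N -> a i = 0.
Proof.
move=> a0.
have ex : exists n, a n != 0.
  apply: contrapT => h; case/eqP: a0; apply: fpsP => n; rewrite coef_fps0.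
  by apply/eqP; apply: contrapT => hn; apply: h; exists n; apply/negP.
case: (ex_minnP ex) => n hn min; exists n; split=> // i lt_in.
by apply/eqP; apply: contraTT lt_in => /min; rewrite -leqNgt.
Qed.

Lemma fps_idomain a b : a * b = 0 -> (a == 0) || (b == 0).
Proof.
move=> ab0; apply/contraT; rewrite negb_or => /andP[].
move=> /fps_valuation[p [ap minp]] /fps_valuation[q [bq minq]].
have /eqP : (a * b) (p + q)%N = 0 by rewrite ab0 coef_fps0.
rewrite coef_fpsM.
have pS : (p < (p + q).+1)%N by rewrite ltnS leq_addr.
rewrite (bigD1 (Ordinal pS)) //= addKn big1 ?addr0 => [|i].
  by rewrite mulf_eq0 (negbTE ap) (negbTE bq).
rewrite -val_eqE /= neq_ltn => /orP[/minp->|lt_pi]; first by rewrite mul0r.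
rewrite minq ?mulr0 // ltn_subLR ?ltn_add2r //.
by rewrite -ltnS ltn_ord.
Qed.

HB.instance Definition _ :=
  GRing.ComUnitRing_isIntegral.Build {fps R} fps_idomain.

End FpsIdomain.

Definition fps_map (R S : comNzRingType) (f : R -> S) (a : {fps R}) : {fps S} :=
  Fps (fun n => f (a n)).

(** * The square root with constant term 1 *)

(* The coefficients b_0, ..., b_(n-1) of the square root b, obtained from
   b_0 = 1 and 2 b_n = a_n - \sum_(0 < i < n) b_i b_(n-i). *)
Fixpoint fps_sqrt_seq (R : comUnitRingType) (a : {fps R}) (n : nat) : seq R :=
  if n is k.+1 then
    let s := fps_sqrt_seq a k in
    rcons s (if k == 0%N then 1
             else (a k - \sum_(1 <= i < k) s`_i * s`_(k - i)) / 2)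
  else [::].

Definition fps_sqrt (R : comUnitRingType) (a : {fps R}) : {fps R} :=
  Fps (fun n => (fps_sqrt_seq a n.+1)`_n).

Section FpsSqrt.
Variable R : idomainType.
Implicit Types a b : {fps R}.

Lemma size_fps_sqrt_seq a n : size (fps_sqrt_seq a n) = n.
Proof. by elim: n => //= n IH; rewrite size_rcons IH. Qed.

Lemma nth_fps_sqrt_seq a n i :
  (i < n)%N -> (fps_sqrt_seq a n)`_i = fps_sqrt a i.
Proof.
elim: n => // n IH; rewrite ltnS leq_eqVlt => /orP[/eqP-> //|lt_in].
by rewrite -IH //= nth_rcons size_fps_sqrt_seq lt_in.
Qed.

Lemma fps_sqrt0 a : fps_sqrt a 0%N = 1.
Proof. by []. Qed.

Lemma fps_sqrtS a n : fps_sqrt a n.+1 =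
  (a n.+1 - \sum_(1 <= i < n.+1) fps_sqrt a i * fps_sqrt a (n.+1 - i)%N) / 2.
Proof.
have seqS k : fps_sqrt_seq a k.+1 = rcons (fps_sqrt_seq a k) (if k == 0%N then 1
    else (a k - \sum_(1 <= i < k)
            (fps_sqrt_seq a k)`_i * (fps_sqrt_seq a k)`_(k - i)) / 2) by [].
rewrite -(nth_fps_sqrt_seq a (ltnSn n.+1)) seqS nth_rcons.
rewrite size_fps_sqrt_seq ltnn eqxx; congr ((_ - _) / _).
apply: eq_big_nat => i /andP[i0 lt_in].
by rewrite !nth_fps_sqrt_seq // ltn_subrL i0.
Qed.

Hypothesis unit2 : (2 : R) \is a GRing.unit.

Lemma fps_sqrtK a : a 0%N = 1 -> fps_sqrt a ^+ 2 = a.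
Proof.
move=> a0; apply: fpsP => -[|n]; rewrite expr2 coef_fpsM.
  by rewrite big_ord1 fps_sqrt0 mulr1 a0.
rewrite -(big_mkord xpredT (fun i => fps_sqrt a i * fps_sqrt a (n.+1 - i)%N)).
rewrite big_nat_recr // big_ltn // subn0 subnn fps_sqrt0 mul1r mulr1.
rewrite -[LHS]/(_ + _ + _) addrAC -mulr2n -mulr_natr {1}fps_sqrtS.
by rewrite divrK // subrK.
Qed.

Lemma fps_sqrt_uniq a b : b ^+ 2 = a -> b 0%N = 1 -> b = fps_sqrt a.
Proof.
move=> ba b0; have a0 : a 0%N = 1.
  by rewrite -ba expr2 coef_fpsM big_ord1 b0 mulr1.
have /eqP : b ^+ 2 = fps_sqrt a ^+ 2 by rewrite fps_sqrtK.
rewrite eqf_sqr => /orP[/eqP//|/eqP bN].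
have /eqP : b 0%N = - 1 by rewrite bN coef_fpsN fps_sqrt0.
rewrite b0 -addr_eq0 => /eqP two0.
by move: unit2; rewrite -[2]/(1 + 1) two0 unitr0.
Qed.

End FpsSqrt.

(** * The fraction field *)

Notation "x %:F" := (@FracField.tofrac _ x) : ring_scope.

Section Roots.
Variable R : idomainType.

Definition zvar : {fraction {fps R}} := (fpsX : {fps R})%:F.

Definition disc : {fps R} :=
  fpsX ^+ 8 - 2 * fpsX ^+ 6 - fpsX ^+ 4 - 2 * fpsX ^+ 2 + 1.

Definition rroot : {fraction {fps R}} :=
  (1 - zvar ^+ 4 - zvar ^+ 2 - (fps_sqrt disc)%:F) / (2 * zvar ^+ 3).

Definition sroot : {fraction {fps R}} :=
  (1 - zvar ^+ 4 - zvar ^+ 2 + (fps_sqrt disc)%:F) / (2 * zvar ^+ 3).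

Lemma coef_fpsMX (a : {fps R}) n : (fpsX * a) n = if n is k.+1 then a k else 0.
Proof.
rewrite coef_fpsM big_ord_recl /= mul0r add0r.
case: n => [|n]; first by rewrite big_ord0.
rewrite big_ord_recl /= mul1r subSS subn0 big1 ?addr0 // => i _.
by rewrite mul0r.
Qed.

Lemma disc0 : disc 0%N = 1.
Proof.
rewrite /disc !(coef_fpsD, coef_fpsN) coef_fps1 ![2 * _]mulrC.
by rewrite !exprS -!mulrA !coef_fpsMX oppr0 !addr0 add0r.
Qed.

Lemma disc_sqrtK : (2 : R) \is a GRing.unit -> fps_sqrt disc ^+ 2 = disc.
Proof. by move=> u2; apply: fps_sqrtK => //; apply: disc0. Qed.

End Roots.

Arguments zvar {R}.
Arguments rroot {R}.
Arguments sroot {R}.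

Lemma unit2_rat : (2 : rat) \is a GRing.unit.
Proof. by rewrite unitfE. Qed.

Lemma unit2_poly_rat : (2 : {poly rat}) \is a GRing.unit.
Proof. by rewrite -polyC_natr rmorph_unit // unitfE. Qed.

(** * Grand zigzag knight's paths *)

Inductive step := N | Nbar | E | Ebar.

Definition bool_of_step (s : step) : bool * bool :=
  match s with
  | N => (true, true) | Nbar => (true, false)
  | E => (false, true) | Ebar => (false, false)
  end.
Definition step_of_bool (b : bool * bool) : step :=
  match b with
  | (true, true) => N | (true, false) => Nbar
  | (false, true) => E | (false, false) => Ebar
  end.
Lemma bool_of_stepK : cancel bool_of_step step_of_bool. Proof. by case. Qed.
HB.instance Definition _ := Finite.copy step (can_type bool_of_stepK).

Definition vec (s : step) : int * int :=
  match s with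
  | N => (1, 2) | Nbar => (1, -2) | E => (2, 1) | Ebar => (2, -1)
  end.

Definition is_up (s : step) : bool := 0 < (vec s).2.

(* A lattice path from the origin is given by its sequence of steps. *)
Implicit Types p : seq step.

Definition points p : seq (int * int) := 0 :: scanl (fun P s => P + vec s) 0 p.
Definition endpoint p : int * int := last 0 (points p).
Definition path_size p : int := (endpoint p).1.
Definition altitude p : int := (endpoint p).2.

Definition zigzag p : bool := sorted (fun s t => is_up s != is_up t) p.
Definition above (y : int) p : bool := all (fun P => y <= P.2) (points p).

Definition ends_up p : bool := (p != [::]) && is_up (last N p).
Definition ends_down p : bool := (p != [::]) && ~~ is_up (last N p).

(** * Generating functions *)

(* Every step moves at least one unit to the right, so that a path of size n
   has at most n steps: see [size_le_path_size]. *)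
Definition gf (A : pred (seq step)) : {fps rat} :=
  Fps (fun n => #|[set p : n.-bseq step | A p & path_size p == n%:Z]|%:R).

Definition fgf (m k : nat) : {fps rat} :=
  gf (fun p => [&& zigzag p, above (- m%:Z) p, altitude p == - m%:Z + k%:Z
                 & (p == [::]) || ends_up p]).

Definition ggf (m k : nat) : {fps rat} :=
  gf (fun p => [&& zigzag p, above (- m%:Z) p, altitude p == - m%:Z + k%:Z
                 & ends_down p]).

Definition total_gf (m : nat) : {fps rat} :=
  gf (fun p => zigzag p && above (- m%:Z) p).

(* \sum_(k >= 0) (a k) u^k as a power series in z over {poly rat}, the variable
   of {poly rat} being u.  The truncation is harmless for a = fgf m, ggf m,
   because a path of size n ends at altitude at most 2n: see [coef_Fgf] and
   [coef_Ggf]. *)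
Definition ugf (m : nat) (a : nat -> {fps rat}) : {fps {poly rat}} :=
  Fps (fun n => \poly_(k < (m + 2 * n).+1) a k n).

Definition Fgf (m : nat) : {fps {poly rat}} := ugf m (fgf m).
Definition Ggf (m : nat) : {fps {poly rat}} := ugf m (ggf m).
Definition Hgf (m : nat) : {fps {poly rat}} := Fgf m + Ggf m.

Definition uvar : {fraction {fps {poly rat}}} := (fpsC 'X : {fps {poly rat}})%:F.

Definition at_u (x : rat) : {fps {poly rat}} -> {fps rat} :=
  fps_map (fun c => c.[x]).

Lemma endpoint_cons s p : endpoint (s :: p) = vec s + endpoint p.
Proof.
rewrite /endpoint /points /= add0r.
have gen (P Q : int * int) q :
    last (P + Q) (scanl (fun P s => P + vec s) (P + Q) q) =
    P + last Q (scanl (fun P s => P + vec s) Q q).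
  by elim: q Q => //= t q IH Q; rewrite -addrA IH.
by rewrite -{1 2}[vec s]addr0 gen.
Qed.

Lemma size_le_path_size p : (size p)%:Z <= path_size p.
Proof.
elim: p => // s p IH; rewrite /path_size endpoint_cons /= -add1n PoszD.
by apply: lerD => //; case: s.
Qed.

Lemma altitude_le p : altitude p <= path_size p *+ 2.
Proof.
elim: p => // s p; rewrite /altitude /path_size !endpoint_cons /= mulrnDl.
by move=> IH; apply: lerD => //; case: s.
Qed.

(* Any bound on the number of steps that is at least n gives the same count. *)
Lemma gf_bseq (A : pred (seq step)) n M : (n <= M)%N ->
  gf A n = #|[set p : M.-bseq step | A p & path_size p == n%:Z]|%:R.
Proof.
move=> leM; congr (_%:R).
pose w (p : n.-bseq step) := widen_bseq leM p.
have wI : injective w by move=> p q /(congr1 val) /= /val_inj.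
rewrite -(card_imset _ wI); apply: eq_card => p; rewrite !inE.
apply/imsetP/idP => [[q]|].
  by rewrite !inE => hq ->.
move=> /[dup] hp /andP[_ /eqP sp].
have sn : (size p <= n)%N by rewrite -lez_nat -sp size_le_path_size.
by exists (Bseq sn); rewrite ?inE //; apply: val_inj.
Qed.

Lemma gf_coef0 (A : pred (seq step)) n :
  (forall p, path_size p = n%:Z -> ~~ A p) -> gf A n = 0.
Proof.
move=> h; rewrite /= (_ : [set _ | _ & _] = set0) ?cards0 //.
apply/setP => p; rewrite !inE; apply/negbTE; apply/negP => /andP[Ap /eqP sp].
by case/negP: (h p sp).
Qed.

Lemma altitude_bound m k n p : path_size p = n%:Z ->
  altitude p = - m%:Z + k%:Z -> (k < (m + 2 * n).+1)%N.
Proof.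
move=> sp ap; have := altitude_le p; rewrite sp ap addrC lerBlDr.
by rewrite -mulr_natl -PoszM -PoszD lez_nat addnC.
Qed.

Lemma coef_Fgf m k n : (Fgf m n)`_k = fgf m k n.
Proof.
rewrite coef_poly; case: ltnP => // lek; rewrite gf_coef0 // => p sp.
apply/negP => /and4P[_ _ /eqP ap _].
by have := altitude_bound sp ap; rewrite ltnNge lek.
Qed.

Lemma coef_Ggf m k n : (Ggf m n)`_k = ggf m k n.
Proof.
rewrite coef_poly; case: ltnP => // lek; rewrite gf_coef0 // => p sp.
apply/negP => /and4P[_ _ /eqP ap _].
by have := altitude_bound sp ap; rewrite ltnNge lek.
Qed.

(* Main.v *)
From HB Require Import structures.
Require Import Defs.
From mathcomp Require Import all_boot all_order all_algebra.
From mathcomp Require Import ring zify.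

(* Removing the last step of a path gives two linear equations relating F(u),
   G(u) and the unknown series f = f_{1-m}; eliminating G(u) yields
     (u - r) F(u) (z^3 s - z^3 u) = P(u),
   with P a polynomial in u.  Instead of substituting u = r in F(u), write
   P(u) = P(r) + (u - r) q: then u - r divides P(r), which is free of u, and
   since r has no constant term this forces P(r) = 0.  This determines f, hence
   F(u) and G(u).  The closed form at u = 1 only needs the two linear equations
   and the value of f. *)

Set Implicit Arguments.
Unset Strict Implicit.
Unset Printing Implicit Defensive.

Import Order.TTheory GRing.Theory Num.Theory.

Local Open Scope ring_scope.

(** * Coefficientwise ring morphisms of power series *)

Section FpsMap.
Variables (R S : comNzRingType) (f : {rmorphism R -> S}).

Lemma fps_map_is_zmod_morphism : zmod_morphism (fps_map f).
Proof. by move=> a b; apply: fpsP => n /=; rewrite rmorphB. Qed.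

Lemma fps_map_is_monoid_morphism : monoid_morphism (fps_map f).
Proof.
split=> [|a b]; apply: fpsP => n.
  by rewrite coef_fps1 -[LHS]/(f ((1 : {fps R}) n)) coef_fps1 rmorph_nat.
rewrite -[LHS]/(f (\sum_(i < n.+1) a i * b (n - i)%N)) coef_fpsM.
by rewrite rmorph_sum; apply: eq_bigr => i _; rewrite rmorphM.
Qed.

HB.instance Definition _ := GRing.isZmodMorphism.Build
  {fps R} {fps S} (fps_map f) fps_map_is_zmod_morphism.
HB.instance Definition _ := GRing.isMonoidMorphism.Build
  {fps R} {fps S} (fps_map f) fps_map_is_monoid_morphism.

Lemma fps_mapX : fps_map f fpsX = fpsX.
Proof. by apply: fpsP => n /=; rewrite rmorph_nat. Qed.

End FpsMap.

(** * The roots [r] and [s] of the kernel *)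

Section FpsTheory.
Variable R : idomainType.
Implicit Types a b c d e : {fps R}.

Lemma fpsX_neq0 : (fpsX : {fps R}) != 0.
Proof.
apply/eqP => /(congr1 (fun a : {fps R} => a 1%N)) /= /eqP.
by rewrite oner_eq0.
Qed.

Lemma fpsMX_inj a b : fpsX * a = fpsX * b -> a = b.
Proof. exact: (mulfI fpsX_neq0). Qed.

Lemma coef0_fpsM a b : (a * b) 0%N = a 0%N * b 0%N.
Proof. by rewrite coef_fpsM big_ord1. Qed.

Lemma coef0_fpsXn n : ((fpsX : {fps R}) ^+ n.+1) 0%N = 0.
Proof. by rewrite exprS coef_fpsMX. Qed.

Lemma fpsX_dvd a : a 0%N = 0 -> exists b, a = fpsX * b.
Proof.
move=> a0; exists (Fps (fun n => a n.+1)).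
by apply: fpsP => -[|n]; rewrite coef_fpsMX.
Qed.

(** The constant terms of both sides show that a factor [d] with nonzero constant term cannot absorb
    the [z], so [z] divides [a]. *)
Lemma fpsX_gauss a d e :
  d 0%N != 0 -> a * d = fpsX * e -> exists2 b, a = fpsX * b & b * d = e.
Proof.
move=> d0 ad; have a0 : a 0%N = 0.
  move/(congr1 (fun c : {fps R} => c 0%N)): ad.
  by rewrite coef0_fpsM coef_fpsMX => /eqP; rewrite mulf_eq0 (negPf d0) orbF => /eqP.
have [b ab] := fpsX_dvd a0; exists b => //.
by apply: fpsMX_inj; rewrite mulrA -ab.
Qed.

Hypothesis unit2 : (2 : R) \is a GRing.unit.

Lemma fps_half a : exists b, a = 2 * b.
Proof.
exists (a * fpsC (2^-1)); rewrite mulrCA -[LHS]mulr1; congr (_ * _).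
apply: fpsP => n; rewrite mulr2n mulrDl mul1r coef_fps1 coef_fpsD /=.
case: eqP => _; last by rewrite addr0.
by rewrite -[_^-1]mul1r -mulrDl divrr.
Qed.

Lemma two_neq0 : (2 : R) != 0.
Proof. by apply: contraTneq unit2 => ->; rewrite unitr0. Qed.

(** Clearing the denominator [2 z^3] makes [r] a genuine series, with coefficients to reason about,
    whereas [rroot] only lives in the fraction field. *)
Definition is_rseries r : Prop :=
  1 - fpsX ^+ 4 - fpsX ^+ 2 - fps_sqrt (disc R) = 2 * fpsX ^+ 3 * r.

(* The difference [c] and the sum [d] of [1 - z^4 - z^2] and the square root
   satisfy [c * d = 4 z^6], and [d] has constant term 2, so [z^3] divides [c]. *)
Lemma rseries_ex : exists r, is_rseries r.
Proof.
rewrite /is_rseries; set q := fps_sqrt _.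
set c := _ - q; pose d : {fps R} := 1 - fpsX ^+ 4 - fpsX ^+ 2 + q.
have d0 : d 0%N != 0.
  by rewrite !(coef_fpsD, coef_fpsN) !coef0_fpsXn coef_fps1 oppr0 !addr0 two_neq0.
have q2 : q ^+ 2 = disc R by apply: disc_sqrtK.
have cd : c * d = fpsX * (fpsX * (fpsX * (4 * fpsX ^+ 3))).
  have -> : c * d = (1 - fpsX ^+ 4 - fpsX ^+ 2) ^+ 2 - q ^+ 2 by rewrite /c /d; ring.
  by rewrite q2 /disc; ring.
have [c1 -> /(fpsX_gauss d0)[c2 -> /(fpsX_gauss d0)[c3 -> _]]] :=
  fpsX_gauss d0 cd.
by have [r ->] := fps_half c3; exists r; ring.
Qed.

Variable r : {fps R}.
Hypothesis rE : is_rseries r.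

(** Solving [is_rseries] for the square root and squaring gives [4 z^3] times this relation, and
    [4 z^3] can be cancelled. *)
Lemma rseries_quad :
  fpsX ^+ 3 * r ^+ 2 + fpsX ^+ 3 = (1 - fpsX ^+ 2 - fpsX ^+ 4) * r.
Proof.
have q2 : fps_sqrt (disc R) ^+ 2 = disc R by apply: disc_sqrtK.
have qE : fps_sqrt (disc R) = 1 - fpsX ^+ 4 - fpsX ^+ 2 - 2 * fpsX ^+ 3 * r.
  by rewrite -rE; ring.
have n4 : (4 * fpsX ^+ 3 : {fps R}) != 0.
  apply: mulf_neq0; last by rewrite expf_neq0 // fpsX_neq0.
  apply/eqP => /(congr1 (fun a : {fps R} => a 0%N)).
  rewrite -[4]/((2 * 2)%:R : {fps R}) natrM coef0_fpsM coef_fps0.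
  rewrite -[2]/(1 + 1 : {fps R}) coef_fpsD coef_fps1 => /eqP.
  by rewrite mulf_eq0 orbb (negPf two_neq0).
apply: (mulfI n4); move: q2; rewrite qE /disc => /eqP; rewrite -subr_eq0 => /eqP h.
by apply/eqP; rewrite -subr_eq0 -h; apply/eqP; ring.
Qed.

Lemma rseries0 : r 0%N = 0.
Proof.
have /(congr1 (fun a : {fps R} => a 0%N)) := rseries_quad.
rewrite coef_fpsD !coef0_fpsM !coef_fpsD !coef_fpsN !coef0_fpsXn coef_fps1.
by rewrite oppr0 !mul0r !addr0 mul1r => <-.
Qed.

Lemma rseries_neq0 : r != 0.
Proof.
apply/eqP => r0; have := rseries_quad; rewrite r0 expr2 !mulr0 add0r => /eqP.
by rewrite expf_eq0 (negPf fpsX_neq0).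
Qed.

(** At [r = -z] the two sides of [rseries_quad] differ by [z]. This allows the factor [u + z] to be
    cancelled at [u = r]. *)
Lemma rseries_addX_neq0 : r + fpsX != 0.
Proof.
apply/eqP => /eqP; rewrite addr_eq0 => /eqP rX.
have /eqP := rseries_quad; rewrite rX -subr_eq0.
by rewrite (_ : _ - _ = fpsX) ?(negPf fpsX_neq0) //; ring.
Qed.

Lemma zvar_neq0 : (zvar : {fraction {fps R}}) != 0.
Proof. by rewrite /zvar tofrac_eq0 fpsX_neq0. Qed.

Lemma two_frac_neq0 : (2 : {fraction {fps R}}) != 0.
Proof.
rewrite -(rmorph_nat (@FracField.tofrac {fps R})) tofrac_eq0.
apply/eqP => /(congr1 (fun a : {fps R} => a 0%N)).
rewrite -[2]/(1 + 1 : {fps R}) coef_fpsD coef_fps1 coef_fps0 => /eqP.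
by rewrite (negPf two_neq0).
Qed.

Lemma rrootE : rroot = r%:F.
Proof.
have d0 : 2 * (zvar : {fraction {fps R}}) ^+ 3 != 0.
  by rewrite mulf_neq0 ?two_frac_neq0 // expf_neq0 // zvar_neq0.
apply: (mulIf d0); rewrite /rroot divfK //.
have := congr1 (@FracField.tofrac {fps R}) rE.
by rewrite !(rmorphB, rmorph1, rmorphM, rmorphXn, rmorph_nat) => ->; rewrite mulrC.
Qed.

(** This is [r + s = (1 - z^2 - z^4) / z^3]. Since [s] has a pole at [z = 0], only [z^3 s] is
    expressed as a series. *)
Lemma sroot_mul :
  zvar ^+ 3 * sroot = (1 - fpsX ^+ 2 - fpsX ^+ 4 - fpsX ^+ 3 * r)%:F.
Proof.
set t : {fps R} := (X in X%:F).
have tE : 1 - fpsX ^+ 4 - fpsX ^+ 2 + fps_sqrt (disc R) = 2 * t.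
  by rewrite -[fps_sqrt _](subKr (1 - fpsX ^+ 4 - fpsX ^+ 2)) rE /t; ring.
have numE : 1 - zvar ^+ 4 - zvar ^+ 2 + (fps_sqrt (disc R))%:F = 2 * t%:F.
  rewrite -(rmorph_nat (@FracField.tofrac {fps R})) -rmorphM -tE.
  by rewrite !(rmorphD, rmorphN, rmorph1, rmorphXn).
rewrite /sroot numE -mulf_div divff ?two_frac_neq0 // mul1r mulrC divfK //.
by rewrite expf_neq0 // zvar_neq0.
Qed.

End FpsTheory.

(** * Paths and generating functions under removal of the last step *)

Implicit Types (p q : seq step) (s : step) (A B : pred (seq step)).

Lemma endpoint_rcons p s : endpoint (rcons p s) = endpoint p + vec s.
Proof.
elim: p => [|t p IH] /=; last by rewrite !endpoint_cons IH addrA.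
by rewrite endpoint_cons addrC.
Qed.

Lemma path_size_rcons p s : path_size (rcons p s) = path_size p + (vec s).1.
Proof. by rewrite /path_size endpoint_rcons. Qed.

Lemma altitude_rcons p s : altitude (rcons p s) = altitude p + (vec s).2.
Proof. by rewrite /altitude endpoint_rcons. Qed.

Lemma points_rcons p s : points (rcons p s) = rcons (points p) (endpoint (rcons p s)).
Proof.
by rewrite /endpoint /points scanl_rcons -rcons_cons [last 0 (rcons _ _)]last_rcons.
Qed.

Lemma above_rcons y p s : above y (rcons p s) = above y p && (y <= altitude (rcons p s)).
Proof. by rewrite /above points_rcons all_rcons andbC. Qed.

Lemma above_altitude y p : above y p -> y <= altitude p.
Proof.
elim/last_ind: p => [|p s _]; first by rewrite /above /= andbT.
by rewrite above_rcons => /andP[].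
Qed.

Lemma zigzag_rcons p s :
  zigzag (rcons p s) = zigzag p && ((p == [::]) || (is_up (last N p) != is_up s)).
Proof. by case: p => //= t p; rewrite rcons_path. Qed.

Lemma ends_up_rcons p s : ends_up (rcons p s) = is_up s.
Proof. by rewrite /ends_up last_rcons; case: p. Qed.

Lemma ends_down_rcons p s : ends_down (rcons p s) = ~~ is_up s.
Proof. by rewrite /ends_down last_rcons; case: p. Qed.

Lemma gfE A n M : (n <= M)%N ->
  gf A n = \sum_(p : M.-bseq step) (A p && (path_size p == n%:Z))%:R.
Proof.
move=> le_nM; rewrite (gf_bseq A le_nM) cardsE -sum1_card natr_sum big_mkcond /=.
by apply: eq_bigr => p _; rewrite unfold_in /=; case: (_ && _).
Qed.

Lemma eq_gf A B : A =1 B -> gf A = gf B.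
Proof.
move=> AB; apply: fpsP => n; rewrite !(gfE _ (leqnn n)).
by apply: eq_bigr => p _; rewrite AB.
Qed.

Lemma gfU A B : (forall p, ~~ (A p && B p)) ->
  gf (fun p => A p || B p) = gf A + gf B.
Proof.
move=> dis; apply: fpsP => n; rewrite coef_fpsD !(gfE _ (leqnn n)) -big_split /=.
apply: eq_bigr => p _; have := dis p.
by case: (A p); case: (B p); case: eqP.
Qed.

Lemma gf_nil (b : bool) : gf (fun p => (p == [::]) && b) = b%:R.
Proof.
apply: fpsP => n; rewrite (gfE _ (leqnn n)) (bigD1 [bseq]) //= big1 => [|p pn].
  rewrite addr0 eq_sym andbC; case: b; last by rewrite andbF coef_fps0.
  by rewrite andbT coef_fps1.
by rewrite -(inj_eq val_inj) /= in pn; rewrite (negPf pn).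
Qed.

Lemma gf0 : gf (fun=> false) = 0.
Proof. by apply: fpsP => n; rewrite gf_coef0 ?coef_fps0. Qed.

(** A nonempty sequence is a last step together with a sequence whose length bound is one less;
    [None] encodes the empty one. *)
Lemma sum_bseq_rcons (V : nmodType) M (F : seq step -> V) :
  \sum_(p : M.+1.-bseq step) F p =
    F [::] + \sum_s \sum_(p : M.-bseq step) F (rcons p s).
Proof.
have szr s (p : M.-bseq step) : (size (rcons p s) <= M.+1)%N.
  by rewrite size_rcons ltnS size_bseq.
pose h (x : option (step * M.-bseq step)) : M.+1.-bseq step :=
  if x is Some sp then Bseq (szr sp.1 sp.2) else [bseq].
(* [belast t q] has at most [M] entries, so [insub_bseq] never falls back on its default. *)
pose g (p : M.+1.-bseq step) : option (step * M.-bseq step) :=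
  if val p is t :: q then Some (last t q, insub_bseq M (belast t q)) else None.
have hK : cancel h g.
  case=> [[s p]|] //=; rewrite /g /=; have := size_rcons p s.
  case E : (rcons p s) => [|t q] // _.
  move: E; rewrite lastI => /rcons_inj[bE lE].
  rewrite -lE -bE; congr (Some (_, _)); apply: val_inj.
  by rewrite /= insubdK ?unfold_in /= ?size_bseq.
have gK : cancel g h.
  move=> p; apply: val_inj; rewrite /g; case E : (val p) => [|t q] //=.
  rewrite insubdK -?lastI // unfold_in /= size_belast.
  by rewrite -ltnS -[(size q).+1]/(size (t :: q)) -E size_bseq.
rewrite (reindex h) /=; last by exists g => ? _; [apply: hK | apply: gK].
rewrite (bigID (fun x : option _ => x == None)) /= big_pred1_eq /=; congr (_ + _).
rewrite pair_bigA /= (reindex_omap Some id) /=; last by case.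
by apply: eq_big => [[s p]|[s p] _] //=; rewrite eqxx.
Qed.

(** The horizontal displacement as a natural number, usable as an exponent of [z]. *)
Definition vx s : nat := if (s == N) || (s == Nbar) then 1 else 2.

Lemma vecE s : vec s = ((vx s)%:Z, (vec s).2).
Proof. by case: s. Qed.

Lemma sum_step (V : nmodType) (F : step -> V) :
  \sum_s F s = F N + F Nbar + F E + F Ebar.
Proof.
rewrite (bigD1 N) //= (bigD1 Nbar) //= (bigD1 E) //= (bigD1 Ebar) //=.
by rewrite big1 ?addr0 ?addrA //; case.
Qed.

Lemma coef_fpsXnM (R : idomainType) k (a : {fps R}) n :
  (fpsX ^+ k * a) n = if (k <= n)%N then a (n - k)%N else 0.
Proof.
elim: k n => [|k IH] n; first by rewrite mul1r subn0.
by rewrite exprS -mulrA coef_fpsMX; case: n => // n; rewrite IH.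
Qed.

Lemma gf_rcons A : gf A =
  (A [::])%:R + \sum_s fpsX ^+ vx s * gf (fun p => A (rcons p s)).
Proof.
(* The bound [n.+1] leaves [n] once the last step is removed, which still suffices for paths of size
   [n - vx s]. *)
apply: fpsP => n; rewrite (gfE _ (leqnSn n)) coef_fpsD.
rewrite (sum_bseq_rcons _ (fun p => (A p && (path_size p == n%:Z))%:R)).
congr (_ + _).
  rewrite -[path_size [::]]/(Posz 0) eqz_nat eq_sym.
  by case: (A [::]); rewrite ?coef_fps1 ?coef_fps0.
rewrite (big_morph (fun a : {fps rat} => a n) (id1 := 0) (op1 := +%R)) //;
  last exact: coef_fps0.
apply: eq_bigr => s _; rewrite coef_fpsXnM.
case: leqP => [le_sn|lt_ns].
  rewrite (gfE _ (leq_subr (vx s) n)); apply: eq_bigr => p _.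
  by congr (_ && _)%:R; rewrite path_size_rcons vecE /= -subzn // eq_sym -subr_eq eq_sym.
(* A remaining path would have negative size. *)
rewrite big1 // => p _; rewrite path_size_rcons vecE /=.
have := size_le_path_size p; case: (A _) => //=; case: eqP => // h; lia.
Qed.

(** * Recurrences for the numbers of paths ending at a given altitude *)

Definition up_at (m : nat) (j : int) : pred (seq step) := fun p =>
  [&& zigzag p, above (- m%:Z) p, altitude p == j & (p == [::]) || ends_up p].

Definition down_at (m : nat) (j : int) : pred (seq step) := fun p =>
  [&& zigzag p, above (- m%:Z) p, altitude p == j & ends_down p].

(** An up-step cannot cross the line from above, so the condition at the new endpoint is automatic.
    The empty path gets its own term because [down_at] excludes it. *)
Lemma up_at_rcons m j p s : up_at m j (rcons p s) =
  is_up s && (((p == [::]) && (j == (vec s).2)) || down_at m (j - (vec s).2) p).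
Proof.
rewrite /up_at /down_at zigzag_rcons above_rcons altitude_rcons ends_up_rcons.
rewrite (_ : rcons p s == [::] = false) /=; last by case: p.
case us: (is_up s); rewrite ?andbF //= andbT.
have vs : 0 <= (vec s).2 by apply: ltW.
have -> : (altitude p == j - (vec s).2) = (altitude p + (vec s).2 == j).
  by rewrite eq_sym subr_eq eq_sym.
case: eqP => [->|/eqP pn] /=.
  have -> : above (- m%:Z) [::] by rewrite /above /= oppr_le0.
  have -> : altitude [::] = 0 by [].
  by rewrite add0r !andbF orbF (le_trans _ vs) ?oppr_le0 //=.
rewrite /ends_down pn /=; case: (zigzag p) => //=.
case: (is_up _) => /=; rewrite ?andbF //= andbT.
case ap: (above _ p) => //=.
by rewrite (le_trans (above_altitude ap)) // lerDl.
Qed.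

(** A down-step may cross the line, so the bound on [j] supplies the condition at the new endpoint.
    Here [up_at] already covers the empty path. *)
Lemma down_at_rcons m (j : int) p s : - m%:Z <= j ->
  down_at m j (rcons p s) = ~~ is_up s && up_at m (j - (vec s).2) p.
Proof.
move=> jm.
rewrite /up_at /down_at zigzag_rcons above_rcons altitude_rcons ends_down_rcons.
case us: (is_up s); rewrite ?andbF //= andbT.
have -> : (altitude p == j - (vec s).2) = (altitude p + (vec s).2 == j).
  by rewrite eq_sym subr_eq eq_sym.
case: (altitude p + _ =P j) => [->|_] /=; last by rewrite !andbF.
rewrite jm !andbT /ends_up.
by case: (p == [::]); case: (zigzag p); case: (is_up _); case: above.
Qed.

Lemma down_at_below m (j : int) : j < - m%:Z -> gf (down_at m j) = 0.
Proof.
move=> jm; rewrite -gf0; apply: eq_gf => p; apply/negP => /and4P[_ ap /eqP aj _].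
by have := above_altitude ap; rewrite aj leNgt jm.
Qed.

Lemma gf_up_at m j : gf (up_at m j) = (j == 0)%:R +
  fpsX * ((j == 2)%:R + gf (down_at m (j - 2))) +
  fpsX ^+ 2 * ((j == 1)%:R + gf (down_at m (j - 1))).
Proof.
rewrite gf_rcons sum_step.
have -> : up_at m j [::] = (j == 0).
  by rewrite /up_at /zigzag /above /= andbT eq_sym oppr_le0 andbT.
have upE s : is_up s -> gf (fun p => up_at m j (rcons p s)) =
    (j == (vec s).2)%:R + gf (down_at m (j - (vec s).2)).
  move=> us; rewrite -(gf_nil (j == _)) -gfU => [|p].
    by apply: eq_gf => p; rewrite up_at_rcons us.
  by apply/negP => /andP[/andP[/eqP -> _]]; rewrite /down_at !andbF.
have dnE s : ~~ is_up s -> gf (fun p => up_at m j (rcons p s)) = 0.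
  by move=> us; rewrite -gf0; apply: eq_gf => p; rewrite up_at_rcons (negPf us).
by rewrite (upE N) // (upE E) // (dnE Nbar) // (dnE Ebar) // !mulr0 !addr0 addrA.
Qed.

Lemma gf_down_at m (j : int) : - m%:Z <= j -> gf (down_at m j) =
  fpsX * gf (up_at m (j + 2)) + fpsX ^+ 2 * gf (up_at m (j + 1)).
Proof.
move=> jm; rewrite gf_rcons sum_step.
have upE s : is_up s -> gf (fun p => down_at m j (rcons p s)) = 0.
  by move=> us; rewrite -gf0; apply: eq_gf => p; rewrite down_at_rcons // us.
have dnE s : ~~ is_up s ->
    gf (fun p => down_at m j (rcons p s)) = gf (up_at m (j - (vec s).2)).
  by move=> us; apply: eq_gf => p; rewrite down_at_rcons // (negPf us).
rewrite (upE N) // (upE E) // (dnE Nbar) // (dnE Ebar) // !mulr0 !addr0 !add0r.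
by rewrite /down_at !andbF add0r /= !opprK.
Qed.

(** This is [gf_up_at] at [j = -m + k]; the zero branches are altitudes below the line. *)
Lemma fgf_rec m k : fgf m k = (k == m)%:R +
  fpsX * ((k == m + 2)%N%:R + (if k is k'.+2 then ggf m k' else 0)) +
  fpsX ^+ 2 * ((k == m + 1)%N%:R + (if k is k'.+1 then ggf m k' else 0)).
Proof.
have shift i : (- m%:Z + k%:Z == i%:Z) = (k == m + i)%N by lia.
rewrite -[LHS]/(gf (up_at m (- m%:Z + k%:Z))) gf_up_at.
rewrite (shift 0%N) (shift 2%N) (shift 1%N) addn0.
congr (_ + _ * (_ + _) + _ * (_ + _)).
  case: k {shift} => [|[|k]]; try by apply: down_at_below; lia.
  by congr (gf (down_at m _)); lia.
case: k {shift} => [|k]; first by apply: down_at_below; lia.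
by congr (gf (down_at m _)); lia.
Qed.

Lemma ggf_rec m k : ggf m k = fpsX * fgf m k.+2 + fpsX ^+ 2 * fgf m k.+1.
Proof.
rewrite -[LHS]/(gf (down_at m (- m%:Z + k%:Z))) gf_down_at; last by lia.
by congr (_ * gf (up_at m _) + _ * gf (up_at m _)); lia.
Qed.

(** An up-step arriving on the line would start below it, and the empty path ends at altitude 0,
    above the line. *)
Lemma fgf0 m : (0 < m)%N -> fgf m 0 = 0.
Proof.
by case: m => // m _; rewrite fgf_rec ?addn1 ?addn2 /= !addr0 !mulr0 !addr0.
Qed.

(** * Coefficients in [u], and divisibility by [u - r] *)

Section Ucoef.
Variable R : idomainType.
Implicit Types (a b : {fps {poly R}}) (c r : {fps R}).

Local Notation lift := (fps_map (@polyC R)).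

Definition fpsU : {fps {poly R}} := fpsC 'X.

(** Reads a series in [z] over polynomials in [u] in the other order, so that functional equations
    reduce to the recurrences on [fgf] and [ggf]. *)
Definition ucoef k a : {fps R} := Fps (fun n => (a n)`_k).

Lemma ucoef_inj a b : (forall k, ucoef k a = ucoef k b) -> a = b.
Proof.
move=> ab; apply: fpsP => n; apply/polyP => k.
by have /(congr1 (fun c : {fps R} => c n)) := ab k.
Qed.

Lemma ucoefD k a b : ucoef k (a + b) = ucoef k a + ucoef k b.
Proof. by apply: fpsP => n /=; rewrite coefD. Qed.

Lemma ucoefN k a : ucoef k (- a) = - ucoef k a.
Proof. by apply: fpsP => n /=; rewrite coefN. Qed.

Lemma ucoef_liftM k c a : ucoef k (lift c * a) = c * ucoef k a.
Proof.
apply: fpsP => n; rewrite coef_fpsM -[LHS]/((lift c * a) n)`_k coef_fpsM coef_sum.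
by apply: eq_bigr => i _; rewrite coefCM.
Qed.

Lemma coef_fpsUM a n : (fpsU * a) n = 'X * a n.
Proof.
rewrite coef_fpsM big_ord_recl /= subn0 big1 ?addr0 // => i _.
by rewrite mul0r.
Qed.

Lemma ucoef_UM k a : ucoef k (fpsU * a) = if k is k'.+1 then ucoef k' a else 0.
Proof.
apply: fpsP => n; rewrite -[LHS]/((fpsU * a) n)`_k coef_fpsUM coefXM.
by case: k => [|k]; rewrite ?coef_fps0.
Qed.

Lemma ucoef1 k : ucoef k 1 = (k == 0%N)%:R.
Proof.
apply: fpsP => n; rewrite -[LHS]/((1 : {fps {poly R}}) n)`_k coef_fps1.
rewrite -polyC_natr coefC; case: (k =P 0%N) => _.
  by rewrite -[RHS]/((1 : {fps R}) n) coef_fps1.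
by rewrite -[RHS]/((0 : {fps R}) n) coef_fps0.
Qed.

Lemma ucoef_Un k m : ucoef k (fpsU ^+ m) = (k == m)%:R.
Proof.
elim: m k => [|m IH] k; first exact: ucoef1.
by rewrite exprS ucoef_UM; case: k.
Qed.

(** Induction on the exponent of [z]. As [r] has no constant term, the coefficient of [z^n] in [r a]
    involves only earlier coefficients of [a], which vanish. Hence [u a_n] equals the constant
    [c_n], and both are zero. *)
Lemma kernel_const r c a : r 0%N = 0 -> (fpsU - lift r) * a = lift c -> c = 0.
Proof.
move=> r0 ac.
have H n : a n = 0 /\ c n = 0.
  elim/ltn_ind: n => n IH.
  have sum0 : (lift r * a) n = 0.
    rewrite coef_fpsM big1 // => i _; rewrite -[lift r i]/((r i)%:P).
    have [i0|i0] := posnP i; first by rewrite i0 r0 mul0r.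
    have [n0|n0] := posnP n; first by case: i i0 => i lti /= i0; lia.
    by rewrite (IH _ _).1 ?mulr0 // ltn_subrL i0 n0.
  have := congr1 (fun b : {fps {poly R}} => b n) ac.
  rewrite mulrBl coef_fpsD coef_fpsN coef_fpsUM sum0 subr0 /= => XaE.
  have cn : c n = 0 by have := coefXM (a n) 0; rewrite XaE coefC eqxx.
  split=> //; apply/eqP; have /eqP := XaE.
  by rewrite cn mulf_eq0 polyX_eq0.
by apply: fpsP => n; rewrite (H n).2 coef_fps0.
Qed.

End Ucoef.

(** * Functional equations for F and G *)

Lemma ucoef_Fgf m k : ucoef k (Fgf m) = fgf m k.
Proof. by apply: fpsP => n; apply: coef_Fgf. Qed.

Lemma ucoef_Ggf m k : ucoef k (Ggf m) = ggf m k.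
Proof. by apply: fpsP => n; apply: coef_Ggf. Qed.

Local Notation lift := (fps_map (@polyC rat)).
Local Notation U := (fpsU rat).

(** The first summand counts the empty path and the two one-step paths; in the second, an up-step
    follows a down-step. *)
Lemma Fgf_eq m : Fgf m =
  U ^+ m * (1 + fpsX ^+ 2 * U + fpsX * U ^+ 2)
    + (fpsX * U ^+ 2 + fpsX ^+ 2 * U) * Ggf m.
Proof.
have expand (D : comNzRingType) (x u G : D) :
    u ^+ m * (1 + x ^+ 2 * u + x * u ^+ 2) + (x * u ^+ 2 + x ^+ 2 * u) * G =
    u ^+ m + x * (u ^+ (m + 2) + u * (u * G)) + x ^+ 2 * (u ^+ (m + 1) + u * G).
  by rewrite !exprD; ring.
rewrite expand -!(fps_mapX (@polyC rat)) -rmorphXn; apply: ucoef_inj => k.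
rewrite !(ucoefD, ucoef_liftM, ucoef_Un) ucoef_Fgf fgf_rec.
by rewrite !ucoef_UM; case: k => [|[|k]]; rewrite ?ucoef_UM ?ucoef_Ggf.
Qed.

(** The factor [u^2] avoids negative powers of [u]. A final [Nbar] lowers the altitude by 2, so the
    coefficients of [u^0] and [u^1] in F must be removed; the former is zero by [fgf0]. *)
Lemma Ggf_eq m : (0 < m)%N ->
  U ^+ 2 * Ggf m = fpsX * (Fgf m - U * lift (fgf m 1)) + fpsX ^+ 2 * (U * Fgf m).
Proof.
move=> m0; rewrite -!(fps_mapX (@polyC rat)) -rmorphXn [U * lift _]mulrC expr2 -mulrA.
apply: ucoef_inj => k.
rewrite !(ucoefD, ucoefN, ucoef_liftM) -[X in _ * ucoef k X]expr1 ucoef_Un ucoef_UM.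
rewrite ucoef_Fgf; case: k => [|[|k]] /=; rewrite !ucoef_UM ?ucoef_Fgf ?(fgf0 m0).
- by rewrite mulr0 subrr !mulr0 addr0.
- by rewrite mulr1 subrr !mulr0 addr0.
- by rewrite ucoef_Ggf mulr0 subr0 ggf_rec.
Qed.

(** After exchanging the sums, each admissible path contributes for exactly one altitude, and to
    exactly one of F and G. *)
Lemma total_gfE m : total_gf m = at_u 1 (Hgf m).
Proof.
apply: fpsP => n.
have atE : (at_u 1 (Hgf m)) n = \sum_(k < (m + 2 * n).+1) (fgf m k n + ggf m k n).
  rewrite /= hornerD !horner_poly -big_split /=.
  by apply: eq_bigr => k _; rewrite expr1n !mulr1.
rewrite atE (gfE _ (leqnn n)).
transitivity (\sum_(k < (m + 2 * n).+1) \sum_(p : n.-bseq step)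
   ((up_at m (- m%:Z + k%:Z) p && (path_size p == n%:Z))%:R +
    (down_at m (- m%:Z + k%:Z) p && (path_size p == n%:Z))%:R : rat)); last first.
  by apply: eq_bigr => k _; rewrite big_split /= -!gfE.
rewrite exchange_big /=; apply: eq_bigr => p _.
have [/eqP pn|_] := boolP (path_size p == n%:Z); last first.
  by rewrite !andbF big1 // => k _; rewrite !andbF addr0.
have ud k : (up_at m (- m%:Z + k%:Z) p && true)%:R +
    (down_at m (- m%:Z + k%:Z) p && true)%:R =
    (zigzag p && above (- m%:Z) p && (altitude p == - m%:Z + k%:Z))%:R :> rat.
  rewrite /up_at /down_at /ends_up /ends_down.
  case: (zigzag p); case: above; case: (altitude p == _); rewrite ?addr0 //=.
  by case: (_ == [::]); case: is_up; rewrite /= ?addr0 ?add0r.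
under eq_bigr do rewrite ud.
have [zp|] := boolP (zigzag p && above (- m%:Z) p); last by rewrite big1.
have /andP[_ /above_altitude am] := zp.
have [k kE] : exists k : nat, altitude p = - m%:Z + k%:Z.
  by exists (absz (altitude p + m%:Z)); lia.
rewrite (bigD1 (Ordinal (altitude_bound pn kE))) //= kE eqxx big1 ?addr0 // => i.
rewrite -val_eqE /= => ik.
by rewrite (_ : _ == _ = false) //; apply/negbTE; move: ik; lia.
Qed.

(* For paths above [y = - m.+1]: [x] is the paper's [z], [f] is [fgf m.+1 1]. *)
Definition zigzag_system (m : nat) (D : comNzRingType) (x u r f F G : D) : Prop :=
  [/\ F = u ^+ m.+1 * (1 + x ^+ 2 * u + x * u ^+ 2)
          + (x * u ^+ 2 + x ^+ 2 * u) * G,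
      u ^+ 2 * G = x * (F - u * f) + x ^+ 2 * (u * F),
      x ^+ 3 * r ^+ 2 + x ^+ 3 = (1 - x ^+ 2 - x ^+ 4) * r
    & x * f = r ^+ m * (x + r * x ^+ 2 + r ^+ 2)].

(** Carries the system to fraction fields and through the evaluation [u = 1]. *)
Lemma zigzag_system_morph m (D D' : comNzRingType) (h : {rmorphism D -> D'})
  (x u r f F G : D) :
  zigzag_system m x u r f F G ->
  zigzag_system m (h x) (h u) (h r) (h f) (h F) (h G).
Proof.
case=> e1 e2 e3 e4; split.
- by rewrite {1}e1 !(rmorphD, rmorphM, rmorphXn, rmorph1).
- by have := congr1 h e2; rewrite !(rmorphD, rmorphN, rmorphM, rmorphXn).
- by have := congr1 h e3; rewrite !(rmorphD, rmorphN, rmorphM, rmorphXn, rmorph1).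
- by have := congr1 h e4; rewrite !(rmorphD, rmorphM, rmorphXn).
Qed.

(** * Kernel method and solution of the system *)

Lemma kernel_factor m (D : comNzRingType) (x u r f F G : D) :
  F = u ^+ m * (1 + x ^+ 2 * u + x * u ^+ 2) + (x * u ^+ 2 + x ^+ 2 * u) * G ->
  u ^+ 2 * G = x * (F - u * f) + x ^+ 2 * (u * F) ->
  x ^+ 3 * r ^+ 2 + x ^+ 3 = (1 - x ^+ 2 - x ^+ 4) * r ->
  (u - r) * (F * (1 - x ^+ 2 - x ^+ 4 - x ^+ 3 * r - x ^+ 3 * u)) =
  u * (u ^+ m * (1 + x ^+ 2 * u + x * u ^+ 2) - x ^+ 2 * (u + x) * f).
Proof.
move=> e1 e2 e3.
have uF : u * F = u ^+ m.+1 * (1 + x ^+ 2 * u + x * u ^+ 2)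
    + (x * u + x ^+ 2) * (x * (F - u * f) + x ^+ 2 * (u * F)).
  by rewrite -e2 {1}e1 [u ^+ m.+1]exprS; ring.
have -> : (u - r) * (F * (1 - x ^+ 2 - x ^+ 4 - x ^+ 3 * r - x ^+ 3 * u)) =
    u * F - (x * u + x ^+ 2) * (x * F + x ^+ 2 * (u * F))
    + F * (x ^+ 3 * r ^+ 2 + x ^+ 3 - (1 - x ^+ 2 - x ^+ 4) * r) by ring.
by rewrite e3 subrr mulr0 addr0 {1}uF [u ^+ m.+1]exprS; ring.
Qed.

Lemma kernel_rhs_dvd m (D : comNzRingType) (x f u v : D) : exists q : D,
  u * (u ^+ m * (1 + x ^+ 2 * u + x * u ^+ 2) - x ^+ 2 * (u + x) * f) =
  v * (v ^+ m * (1 + x ^+ 2 * v + x * v ^+ 2) - x ^+ 2 * (v + x) * f)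
  + (u - v) * q.
Proof.
pose S n := \sum_(i < n) u ^+ (n.-1 - i) * v ^+ i.
have SE n : u ^+ n = (u - v) * S n + v ^+ n by rewrite -subrXX subrK.
(* [S n] is the quotient of [u^n - v^n] by [u - v], and [u + v + x] is that of
   [(u^2 + x u) - (v^2 + x v)]. *)
exists (S m.+1 + x ^+ 2 * S m.+2 + x * S m.+3 - x ^+ 2 * (u + v + x) * f).
have expand w : w * (w ^+ m * (1 + x ^+ 2 * w + x * w ^+ 2) - x ^+ 2 * (w + x) * f) =
    w ^+ m.+1 + x ^+ 2 * w ^+ m.+2 + x * w ^+ m.+3 - x ^+ 2 * (w * w + x * w) * f.
  by rewrite [w ^+ m.+3]exprS [w ^+ m.+2]exprS [w ^+ m.+1]exprS; ring.
by rewrite !expand !SE; ring.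
Qed.

(** The quadratic relation turns [r (1 + x^2 r + x r^2)] into [x (r + x) (x + r x^2 + r^2)], so
    [x (r + x)] cancels. *)
Lemma kernel_root m (D : idomainType) (x r f : D) :
  x != 0 -> r != 0 -> r + x != 0 ->
  x ^+ 3 * r ^+ 2 + x ^+ 3 = (1 - x ^+ 2 - x ^+ 4) * r ->
  r * (r ^+ m.+1 * (1 + x ^+ 2 * r + x * r ^+ 2) - x ^+ 2 * (r + x) * f) = 0 ->
  x * f = r ^+ m * (x + r * x ^+ 2 + r ^+ 2).
Proof.
move=> x0 r0 rx0 e /eqP; rewrite mulf_eq0 (negPf r0) /= subr_eq0 => /eqP h.
apply: (mulfI x0); apply: (mulfI rx0).
have -> : (r + x) * (x * (x * f)) = x ^+ 2 * (r + x) * f by ring.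
rewrite -h [r ^+ m.+1]exprS; apply/eqP; rewrite -subr_eq0; apply/eqP.
have -> : r * r ^+ m * (1 + x ^+ 2 * r + x * r ^+ 2) -
    (r + x) * (x * (r ^+ m * (x + r * x ^+ 2 + r ^+ 2))) =
    r ^+ m * ((1 - x ^+ 2 - x ^+ 4) * r - (x ^+ 3 * r ^+ 2 + x ^+ 3)) by ring.
by rewrite e subrr mulr0.
Qed.

Lemma zigzag_system_gf m (r : {fps rat}) : is_rseries r ->
  zigzag_system m fpsX U (lift r) (lift (fgf m.+1 1)) (Fgf m.+1) (Ggf m.+1).
Proof.
move=> rE.
have e1 := Fgf_eq m.+1; have e2 := @Ggf_eq m.+1 isT.
have quad := rseries_quad unit2_rat rE.
have e3 : fpsX ^+ 3 * lift r ^+ 2 + fpsX ^+ 3 = (1 - fpsX ^+ 2 - fpsX ^+ 4) * lift r.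
  have := congr1 lift quad.
  by rewrite !(rmorphD, rmorphN, rmorphM, rmorphXn, rmorph1) /= !fps_mapX.
split=> //.
have [q qE] := kernel_rhs_dvd m.+1 (fpsX : {fps {poly rat}}) (lift (fgf m.+1 1)) U (lift r).
have := kernel_factor e1 e2 e3; rewrite {}qE => /eqP.
rewrite -subr_eq -mulrBr => /eqP.
set c := (X in _ = X).
(* The value at [u = r] is free of [u], so [kernel_const] makes it vanish. *)
have -> : c = lift (r * (r ^+ m.+1 * (1 + fpsX ^+ 2 * r + fpsX * r ^+ 2)
                         - fpsX ^+ 2 * (r + fpsX) * fgf m.+1 1)).
  by rewrite !(rmorphD, rmorphN, rmorphM, rmorphXn, rmorph1) /= !fps_mapX.
move/(kernel_const (rseries0 unit2_rat rE)).
move/(kernel_root (fpsX_neq0 _) (rseries_neq0 unit2_rat rE)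
  (rseries_addX_neq0 unit2_rat rE) quad) => /(congr1 lift).
by rewrite !(rmorphD, rmorphM, rmorphXn) /= !fps_mapX.
Qed.

Lemma zigzag_system_solution m (K : fieldType) (x u r s f F G : K) :
  zigzag_system m x u r f F G ->
  x ^+ 3 * s = 1 - x ^+ 2 - x ^+ 4 - x ^+ 3 * r ->
  x != 0 -> u != 0 -> u - r != 0 -> u - s != 0 ->
  F = - ((u * (u ^+ m.+1 * (1 + x ^+ 2 * u + x * u ^+ 2)
                 - r ^+ m * x * (u + x) * (x + r * x ^+ 2 + r ^+ 2)))
           / (x ^+ 3 * (u - r) * (u - s)))
  /\ G = (r ^+ m * (x + r ^+ 2 + x ^+ 2 * r)
         - x * u ^+ m * (1 + x * u) * (1 + x ^+ 2 * u + x * u ^+ 2))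
        / (x ^+ 3 * (u - r) * (u - s)).
Proof.
move=> [e1 e2 e3 e4] sE x0 u0 ur us.
have k0 : x ^+ 3 * (u - r) * (u - s) != 0 by rewrite !mulf_neq0 // expf_neq0.
have kE := kernel_factor e1 e2 e3.
have FK : F * (x ^+ 3 * (u - r) * (u - s)) =
    - (u * (u ^+ m.+1 * (1 + x ^+ 2 * u + x * u ^+ 2)
            - r ^+ m * x * (u + x) * (x + r * x ^+ 2 + r ^+ 2))).
  have -> : r ^+ m * x * (u + x) * (x + r * x ^+ 2 + r ^+ 2) =
    x * (u + x) * (r ^+ m * (x + r * x ^+ 2 + r ^+ 2)) by ring.
  rewrite -e4.
  have -> : x * (u + x) * (x * f) = x ^+ 2 * (u + x) * f by ring.
  by rewrite -kE -sE; ring.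
split; first by rewrite -mulNr -FK mulfK.
apply: (mulIf k0); rewrite divfK //; apply: (mulfI (expf_neq0 2 u0)).
(* Expanding the kernel eliminates [r] and [s], so that the closed form of G becomes a polynomial
   identity. *)
have Kker : x ^+ 3 * (u - r) * (u - s) = x ^+ 2 * (u + x) * (1 + x * u) - u.
  have -> : x ^+ 3 * (u - r) * (u - s) = (u - r) * (x ^+ 3 * u - x ^+ 3 * s) by ring.
  rewrite sE; apply/eqP; rewrite -subr_eq0; apply/eqP.
  have -> : (u - r) * (x ^+ 3 * u - (1 - x ^+ 2 - x ^+ 4 - x ^+ 3 * r)) -
     (x ^+ 2 * (u + x) * (1 + x * u) - u) =
     (1 - x ^+ 2 - x ^+ 4) * r - (x ^+ 3 * r ^+ 2 + x ^+ 3) by ring.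
  by rewrite e3 subrr.
have -> k : u ^+ 2 * (G * k) = (x + x ^+ 2 * u) * (F * k) - u * (x * f) * k.
  by rewrite mulrA e2; ring.
by rewrite FK Kker e4 [u ^+ m.+1]exprS; ring.
Qed.

(** At [u = 1] the two linear equations are symmetric in F and G up to their constant terms; adding
    them gives an equation in [F + G] alone. *)
Lemma zigzag_system_at1 m (K : fieldType) (x r f F G : K) :
  zigzag_system m x 1 r f F G -> x ^+ 2 + x - 1 != 0 ->
  F + G = (x * r ^+ m + x ^+ 2 * r ^+ m.+1 + r ^+ m.+2 - x ^+ 2 - x - 1)
          / (x ^+ 2 + x - 1).
Proof.
case; rewrite !expr1n !mulr1 !mul1r => e1 e2 _ e4 k0.
apply: (mulIf k0); rewrite divfK //.
have -> : (F + G) * (x ^+ 2 + x - 1) = (x + x ^+ 2) * G - F + ((x + x ^+ 2) * F - G) by ring.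
have -> : (x + x ^+ 2) * G - F = - (1 + x ^+ 2 + x) by rewrite e1; ring.
have -> : (x + x ^+ 2) * F - G = x * f by rewrite e2; ring.
by rewrite e4 [r ^+ m.+2]exprS [r ^+ m.+1]exprS; ring.
Qed.

(** By uniqueness of the square root with constant term 1, one series [r] serves over both
    coefficient rings. *)
Lemma is_rseries_lift (r : {fps rat}) : is_rseries r -> is_rseries (lift r).
Proof.
rewrite /is_rseries => rE.
have <- : lift (fps_sqrt (disc rat)) = fps_sqrt (disc {poly rat}).
  apply: (fps_sqrt_uniq unit2_poly_rat) => //.
  rewrite -rmorphXn disc_sqrtK ?unit2_rat // /disc.
  by rewrite !(rmorphD, rmorphN, rmorphM, rmorphXn, rmorph1, rmorph_nat) /= !fps_mapX.
have := congr1 lift rE.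
by rewrite !(rmorphD, rmorphN, rmorphM, rmorphXn, rmorph1, rmorph_nat) /= !fps_mapX.
Qed.

Theorem theorem4p1 (m : nat) (hm : (1 <= m)%N) :
  [/\ (* F(u) and G(u), in the fraction field of Q[u][[z]] *)
      let z : {fraction {fps {poly rat}}} := zvar in
      let u : {fraction {fps {poly rat}}} := uvar in
      let r : {fraction {fps {poly rat}}} := rroot in
      let s : {fraction {fps {poly rat}}} := sroot in
      (Fgf m)%:F =
        - ((u * (u ^+ m * (1 + z ^+ 2 * u + z * u ^+ 2)
                 - r ^+ (m - 1) * z * (u + z) * (z + r * z ^+ 2 + r ^+ 2)))
           / (z ^+ 3 * (u - r) * (u - s)))
      /\
      (Ggf m)%:F =
        (r ^+ (m - 1) * (z + r ^+ 2 + z ^+ 2 * r)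
         - z * u ^+ (m - 1) * (1 + z * u) * (1 + z ^+ 2 * u + z * u ^+ 2))
        / (z ^+ 3 * (u - r) * (u - s)),
      total_gf m = at_u 1 (Hgf m)
    & (* H(1), in the fraction field of Q[[z]] *)
      let z : {fraction {fps rat}} := zvar in
      let r : {fraction {fps rat}} := rroot in
      (at_u 1 (Hgf m))%:F =
        (z * r ^+ (m - 1) + z ^+ 2 * r ^+ m + r ^+ (m + 1) - z ^+ 2 - z - 1)
        / (z ^+ 2 + z - 1)].
Proof.
case: m hm => // m _; rewrite subn1 addn1 /=.
have [r rE] := rseries_ex unit2_rat.
have rE' := is_rseries_lift rE.
have sys := zigzag_system_gf m rE.
split; last 1 first.
- rewrite (rrootE unit2_rat rE).
  (* Evaluation at [u = 1] is a ring morphism fixing series free of [u], so it transports the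
     system. *)
  pose h : {rmorphism {fps {poly rat}} -> {fps rat}} := fps_map (horner_eval (1 : rat)).
  have hlift c : h (lift c) = c by apply: fpsP => n /=; rewrite /horner_eval hornerC.
  have hU : h U = 1.
    apply: fpsP => n; rewrite coef_fps1 /= /horner_eval.
    by case: eqP => _; rewrite ?hornerX ?horner0.
  have := zigzag_system_morph (@FracField.tofrac {fps rat}) (zigzag_system_morph h sys).
  have hX : h fpsX = fpsX by apply: fps_mapX.
  rewrite !hlift hU hX rmorph1 => sys1.
  rewrite -[at_u 1 (Hgf _)]/(h (Fgf m.+1 + Ggf m.+1)) !rmorphD.
  apply: (zigzag_system_at1 sys1).
  rewrite -rmorphXn -rmorphD -(rmorph1 (@FracField.tofrac {fps rat})) -rmorphB tofrac_eq0.
  apply/eqP => /(congr1 (fun a : {fps rat} => a 0%N)).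
  by rewrite !(coef_fpsD, coef_fpsN) coef0_fpsXn coef_fps1 coef_fps0.
- rewrite (rrootE unit2_poly_rat rE').
  have sysF := zigzag_system_morph (@FracField.tofrac {fps {poly rat}}) sys.
  have sE := sroot_mul unit2_poly_rat rE'.
  have u0 : uvar != 0.
    rewrite tofrac_eq0; apply/eqP => /(congr1 (fun a : {fps {poly rat}} => a 0%N)).
    by move/eqP; rewrite coef_fps0 polyX_eq0.
  have ur : uvar - (lift r)%:F != 0.
    rewrite -rmorphB tofrac_eq0; apply/eqP => /(congr1 (fun a : {fps {poly rat}} => a 0%N)).
    rewrite coef_fpsD coef_fpsN coef_fps0 /= (rseries0 unit2_rat rE) subr0 => /eqP.
    by rewrite polyX_eq0.
  (* The series [z^3 s] has constant term 1, while [z^3 u] has constant term 0. *)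
  have us : uvar - sroot != 0.
    rewrite subr_eq0; apply/eqP => su; move/eqP: sE.
    rewrite -su -rmorphXn -rmorphM tofrac_eq; apply/negP/eqP.
    move/(congr1 (fun a : {fps {poly rat}} => a 0%N)).
    rewrite !(coef_fpsD, coef_fpsN, coef0_fpsXn, coef0_fpsM) coef_fps1.
    by rewrite !mul0r oppr0 !addr0 => /esym/eqP; rewrite oner_eq0.
  apply: (zigzag_system_solution sysF) => //; last exact: zvar_neq0.
  by rewrite sE !(rmorphB, rmorphXn, rmorphM, rmorph1).
- exact: total_gfE.
Qed.
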